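(* Each of the following families of games is forced and miserable but not pet: Rook on the set of all rectangles; King on the set of all rectangles; Rook on the set of all nonempty subpartitions of generalized staircases.
   Context: A partition is a finite weakly decreasing sequence $\lambda=[\lambda_1,\ldots,\lambda_r]$ of positive integers; $[\,]$ is the empty partition, and $\mathbb Y^+$ is the set of nonempty partitions. For $i,j\ge 0$, $\lambda[i,j]=[\lambda_{i+1}-j,\lambda_{i+2}-j,\ldots]$ with trailing nonpositive entries removed. For a moveset $M\subseteq \mathbb Z_{\ge0}^2\setminus\{(0,0)\}$ and $\lambda\in\mathbb Y^+$, the impartial chess game $(M,\lambda)$ starts at $\lambda$, and from a position $\mu\in\mathbb Y^+$ a player may move to $\mu[i,j]$ for any $(i,j)\in M$ with $\mu[i,j]\ne[\,]$. The positions of $(M,\lambda)$ are the partitions reachable from $\lambda$ by zero or more moves. A position is terminal if it has no moves. Movesets: King $\{(0,1),(1,0),(1,1)\}$; Rook $\{(k,0):k\ge1\}\cup\{(0,k):k\ge1\}$. Rectangles are the partitions $[c^r]$ ($c$ repeated $r$ times), $r,c\ge1$; the generalized staircase with parameters $r,c,k\ge1$ is $[(kc)^r,((k-1)c)^r,\ldots,c^r]$ (exponents denote repetition). A nonempty subpartition of a generalized staircase $\lambda$ is a partition $\lambda[i,j]\neq[\,]$ with $i,j\ge0$. The Sprague-Grundy value of a position $p$ is $\mathrm{mex}$ of the Sprague-Grundy values of the positions reachable in one move ($0$ if $p$ is terminal), where $\mathrm{mex}(S)$ is the least nonnegative integer not in $S$. The misère Grundy value is defined by the same mex recursion at non-terminal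 positions, but terminal positions have value $1$. A position with Sprague-Grundy value $t$ and misère Grundy value $\ell$ is called a $(t,\ell)$-position. A game is forced if each move from a $(0,1)$-position results in a $(1,0)$-position and each move from a $(1,0)$-position results in a $(0,1)$-position. A game is miserable if for every position $x$ one of the following holds: (i) $x$ is a $(0,1)$-position or a $(1,0)$-position; (ii) there is no move from $x$ to a $(0,1)$-position or a $(1,0)$-position; (iii) there are moves from $x$ to both a $(0,1)$-position and a $(1,0)$-position. A game is pet if it has only $(0,1)$-positions, $(1,0)$-positions, and $(k,k)$-positions with $k\ge2$. For a moveset $M$ and a set $P\subseteq\mathbb Y^+$, the family $(M,P)$ has one of these properties if $(M,\lambda)$ has it for every $\lambda\in P$, and it does not have the property if $(M,\lambda)$ fails it for at least one $\lambda\in P$. *)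

(* Defs.v *)
From mathcomp Require Import all_boot.

Set Implicit Arguments.
Unset Strict Implicit.
Unset Printing Implicit Defensive.

Definition is_partition (s : seq nat) : bool :=
  sorted geq s && all (leq 1) s.

(** [subpart s i j] is s[i,j].  In a weakly decreasing sequence the entries
    that become nonpositive after subtracting j are exactly a tail, so keeping
    the entries larger than j is the same as trimming trailing ones. *)
Definition subpart (s : seq nat) (i j : nat) : seq nat :=
  [seq x - j | x <- drop i s & j < x].

Lemma subpart_partition s i j : is_partition s -> is_partition (subpart s i j).
Proof.
case/andP=> ss _; apply/andP; split; last first.
  apply/allP=> y /mapP[x]; rewrite mem_filter => /andP[jx _] ->.
  by rewrite subn_gt0.
apply: (homo_sorted (e := geq)) => [x y /= le_yx|]; first exact: leq_sub2r.
have geqT : transitive geq by move=> y x z /= yx zy; exact: leq_trans zy yx.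
apply: (subseq_sorted geqT _ ss).
exact: subseq_trans (filter_subseq _ _) (drop_subseq _ _).
Qed.

Record moveset := Moveset {
  allowed :> nat -> nat -> bool;
  allowed00 : ~~ allowed 0 0
}.

Definition king : moveset :=
  @Moveset (fun i j => (i, j) \in [:: (0, 1); (1, 0); (1, 1)]) isT.

Definition rook : moveset :=
  @Moveset (fun i j => (1 <= i) && (j == 0) || (i == 0) && (1 <= j)) isT.

Definition move (M : moveset) (mu nu : seq nat) : Prop :=
  exists i j, [/\ M i j, nu = subpart mu i j & nu <> [::]].

Inductive position (M : moveset) (lam : seq nat) : seq nat -> Prop :=
| position_start : position M lam lam
| position_move mu nu : position M lam mu -> move M mu nu -> position M lam nu.

(** The bounds on i and j lose no move: beyond them the result is empty. *)
Definition options (M : moveset) (mu : seq nat) : seq (seq nat) :=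
  [seq nu <- [seq subpart mu ij.1 ij.2
               | ij <- allpairs pair (iota 0 (size mu))
                                     (iota 0 (foldr maxn 0 mu)) & M ij.1 ij.2]
     | nu != [::]].

Lemma optionsP (M : moveset) mu nu : reflect (move M mu nu) (nu \in options M mu).
Proof.
apply: (iffP idP).
  rewrite mem_filter => /andP[/eqP nz /mapP[[i j]]].
  by rewrite mem_filter => /andP[Mij _] def_nu; exists i, j.
case=> i [j [Mij def_nu /eqP nz]]; rewrite mem_filter nz.
apply/mapP; exists (i, j) => //; rewrite mem_filter Mij /=.
have [x]: exists x, x \in subpart mu i j.
  rewrite -def_nu; case: nu nz {def_nu} => // x s _.
  by exists x; rewrite inE eqxx.
case/mapP=> y; rewrite mem_filter => /andP[jy y_in] _.
have lt_i : i < size mu.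
  by rewrite ltnNge; apply/negP=> le; move: y_in; rewrite drop_oversize ?in_nil.
apply/allpairsP; exists (i, j); split=> //=; rewrite mem_iota //=.
apply: leq_trans jy _; move/mem_drop: y_in.
elim: mu {def_nu lt_i} => //= z s IH; rewrite inE => /predU1P[->|/IH le].
  exact: leq_maxl.
by rewrite leq_max le orbT.
Qed.

Lemma mex_ex (s : seq nat) : exists n, n \notin s.
Proof.
exists (foldr maxn 0 s).+1; apply/negP.
suff H n : n \in s -> n <= foldr maxn 0 s by move/H; rewrite ltnn.
elim: s => //= z s IH; rewrite inE => /predU1P[->|/IH le].
  exact: leq_maxl.
by rewrite leq_max le orbT.
Qed.

Definition mex (s : seq nat) : nat := ex_minn (mex_ex s).

(** [value_rec t M n mu] is the mex recursion in which terminal positions have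
    value t; n only bounds the recursion depth.  Every move strictly decreases
    [size mu + sumn mu], so this fuel suffices (see [valueE]). *)
Fixpoint value_rec (t : nat) (M : moveset) (n : nat) (mu : seq nat) : nat :=
  if n is n'.+1 then
    if options M mu is [::] then t
    else mex [seq value_rec t M n' nu | nu <- options M mu]
  else t.

Definition value (t : nat) (M : moveset) (mu : seq nat) : nat :=
  value_rec t M (size mu + sumn mu) mu.

Definition sprague_grundy := value 0.
Definition misere_grundy := value 1.

Lemma move_measure (M : moveset) mu nu :
  move M mu nu -> size nu + sumn nu < size mu + sumn mu.
Proof.
case=> i [j [Mij -> nz]].
have le_sub s : size [seq x - j | x <- s & j < x]
      + sumn [seq x - j | x <- s & j < x] <= size s + sumn s.
  elim: s => //= x s IH; case: ifP => _ /=.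
    by rewrite !addSn ltnS !(addnCA (size _)) leq_add ?leq_subr.
  by apply: leq_trans IH _; rewrite leq_add ?leq_addl.
case: i => [|i] in Mij nz *; last first.
  case: mu nz => //= x s _; apply: leq_ltn_trans (le_sub (drop i s)) _.
  rewrite addSn ltnS leq_add ?size_drop ?leq_subr //.
  by rewrite -{2}(cat_take_drop i s) sumn_cat addnA leq_addl.
have j0 : 0 < j by case: j Mij {nz le_sub} => //; rewrite (negPf (allowed00 M)).
rewrite /subpart drop0 in nz *.
elim: mu nz => //= x s IH; case: ifP => jx nz /=.
  rewrite !addSn ltnS !(addnCA (size _)) -addSn leq_add //.
  by rewrite -{2}(subnK (ltnW jx)) -addn1 leq_add2l.
by apply: leq_trans (IH nz) _; rewrite leq_add ?leq_addl.
Qed.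

Lemma valueE t (M : moveset) mu :
  value t M mu =
    if options M mu is [::] then t
    else mex [seq value t M nu | nu <- options M mu].
Proof.
have fuel n m nu : size nu + sumn nu <= n -> size nu + sumn nu <= m ->
    value_rec t M n nu = value_rec t M m nu.
  have no_move k : size k + sumn k <= 0 -> options M k = [::].
    by case: k.
  elim: n m nu => [|n IH] [|m] nu Hn Hm //=.
  - by rewrite no_move.
  - by rewrite no_move.
  have -> : [seq value_rec t M n k | k <- options M nu]
          = [seq value_rec t M m k | k <- options M nu].
    apply/eq_in_map=> k /optionsP/move_measure lt_k.
    by apply: IH; rewrite -ltnS; apply: leq_trans lt_k _.
  by [].
rewrite /value (fuel _ (size mu + sumn mu).+1) //=.
have -> : [seq value_rec t M (size mu + sumn mu) nu | nu <- options M mu]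
        = [seq value_rec t M (size nu + sumn nu) nu | nu <- options M mu].
  by apply/eq_in_map=> k /optionsP/move_measure lt_k; apply: fuel => //; apply: ltnW.
by [].
Qed.

Definition tl_position (M : moveset) (x : seq nat) (t l : nat) : Prop :=
  sprague_grundy M x = t /\ misere_grundy M x = l.

Definition forced (M : moveset) (lam : seq nat) : Prop :=
  forall x y, position M lam x -> move M x y ->
    (tl_position M x 0 1 -> tl_position M y 1 0) /\
    (tl_position M x 1 0 -> tl_position M y 0 1).

Definition miserable (M : moveset) (lam : seq nat) : Prop :=
  forall x, position M lam x ->
    [\/ tl_position M x 0 1 \/ tl_position M x 1 0,
        ~ (exists y, move M x y /\ (tl_position M y 0 1 \/ tl_position M y 1 0))
      | (exists y, move M x y /\ tl_position M y 0 1) /\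
        (exists y, move M x y /\ tl_position M y 1 0)].

Definition pet (M : moveset) (lam : seq nat) : Prop :=
  forall x, position M lam x ->
    [\/ tl_position M x 0 1, tl_position M x 1 0
      | exists k, 2 <= k /\ tl_position M x k k].

Definition family_has (prop : moveset -> seq nat -> Prop)
    (M : moveset) (P : seq nat -> Prop) : Prop :=
  forall lam, P lam -> prop M lam.

Definition family_fails (prop : moveset -> seq nat -> Prop)
    (M : moveset) (P : seq nat -> Prop) : Prop :=
  exists lam, P lam /\ ~ prop M lam.

Definition rectangle (lam : seq nat) : Prop :=
  exists r c, [/\ 1 <= r, 1 <= c & lam = nseq r c].

Definition staircase (r c k : nat) : seq nat :=
  flatten [seq nseq r (m * c) | m <- rev (iota 1 k)].

Definition staircase_subpartition (lam : seq nat) : Prop :=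
  exists r c k i j, [/\ 1 <= r, 1 <= c, 1 <= k,
    lam = subpart (staircase r c k) i j & lam <> [::]].

Lemma rectangle_partition lam :
  rectangle lam -> is_partition lam /\ lam <> [::].
Proof.
case=> r [c [r1 c1 ->]]; split; last by case: r r1.
rewrite /is_partition all_nseq c1 orbT andbT.
by case: r {r1} => //= r; elim: r => //= r ->; rewrite leqnn.
Qed.

Lemma staircase_partition r c k : 1 <= c -> is_partition (staircase r c k).
Proof.
move=> c1; apply/andP; split; last first.
  apply/allP=> x /flatten_mapP[m]; rewrite mem_rev mem_iota => /andP[m1 _].
  by rewrite mem_nseq => /andP[_ /eqP->]; rewrite muln_gt0 m1.
have geqT : transitive geq by move=> y x z /= yx zy; exact: leq_trans zy yx.
rewrite sorted_pairwise // /staircase.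
elim: k => // k IH.
rewrite -[k.+1]addn1 iotaD rev_cat map_cat flatten_cat pairwise_cat IH andbT.
rewrite /= cats0; apply/andP; split.
  apply/allrelP=> x y; rewrite mem_nseq => /andP[_ /eqP->].
  case/flatten_mapP=> m; rewrite mem_rev mem_iota => /andP[_ mk].
  rewrite mem_nseq => /andP[_ /eqP->] /=.
  by rewrite leq_mul2r (ltnW mk) orbT.
elim: {IH}r => //= r ->; rewrite andbT; apply/allP=> x.
by rewrite mem_nseq => /andP[_ /eqP->] /=.
Qed.

Lemma staircase_subpartition_partition lam :
  staircase_subpartition lam -> is_partition lam /\ lam <> [::].
Proof.
case=> r [c [k [i [j [_ c1 _ -> nz]]]]]; split=> //.
exact/subpart_partition/staircase_partition.
Qed.

(* Main.v *)
(** Suppose the positions carry disjoint classes [Z] and [O] such that moves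
    from [Z] lead to [O], moves from [O] (there is one) lead to [Z], and any
    other position has either some option and none in [Z] or [O], or options in
    both.  By induction [Z] and [O] consist of the (0,1)- and (1,0)-positions,
    and elsewhere the normal and misere values agree: exchanging 0 and 1 on
    [Z] and [O] does not change the set of option values when both occur.  Such
    a game is forced and miserable.

    For King on rectangles, [Z] and [O] are the one-row and one-column
    rectangles, split by parity.  For Rook on staircases, hence on rectangles,
    [Z = {[1], [2,2]}] and [O = {[2], [1,1], [2,1]}], where [2,1] matters only
    for blocks of size 1 x 1.  In both games the 3 x 3 square is a
    (0,0)-position, since each of its options can move to [Z]. *)

Require Import Defs.
From mathcomp Require Import all_boot.

Set Implicit Arguments.
Unset Strict Implicit.
Unset Printing Implicit Defensive.

(** * Mex and Grundy values *)

Lemma mexP (s : seq nat) n :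
  mex s = n <-> n \notin s /\ (forall m, m < n -> m \in s).
Proof.
rewrite /mex; case: ex_minnP => k kNs k_min; split=> [<-|[nNs n_min]].
  split=> // m; rewrite ltnNge => lt_mk; apply/negPn/negP=> /k_min.
  by apply/negP.
apply/eqP; rewrite eqn_leq k_min // leqNgt; apply/negP=> /n_min.
by apply/negP.
Qed.

Lemma eq_mex (s1 s2 : seq nat) : s1 =i s2 -> mex s1 = mex s2.
Proof.
move=> eq_s; have [nN lt_n] := (mexP s2 (mex s2)).1 erefl.
by apply/mexP; split=> [|m /lt_n]; rewrite eq_s.
Qed.

Lemma value_move t (M : moveset) x :
  (exists y, move M x y) ->
  value t M x = mex [seq value t M y | y <- options M x].
Proof. by case=> y /optionsP; rewrite valueE; case: (options M x). Qed.

Lemma value_eq0 t (M : moveset) x :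
  t = 0 \/ (exists y, move M x y) ->
  (forall y, move M x y -> value t M y <> 0) -> value t M x = 0.
Proof.
move=> def_t nz; rewrite valueE; case def_o: (options M x) => [|y s].
  by case: def_t => // -[y /optionsP]; rewrite def_o.
rewrite -def_o; apply/mexP; split=> //; apply/negP=> /mapP[z /optionsP/nz].
by move/[swap]=> <-.
Qed.

Lemma value_eq1 t (M : moveset) x :
  t = 1 \/ (exists y, move M x y) ->
  (forall y, move M x y -> value t M y = 0) -> value t M x = 1.
Proof.
move=> def_t z; rewrite valueE; case def_o: (options M x) => [|y s].
  by case: def_t => // -[y /optionsP]; rewrite def_o.
rewrite -def_o; apply/mexP; split=> [|[|m] // _].
  by apply/negP=> /mapP[w /optionsP/z ->].
have y_o: y \in options M x by rewrite def_o mem_head.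
by apply/mapP; exists y; rewrite ?(z y) //; apply/optionsP.
Qed.

(** * Dichotomies and their consequences *)

(** Terminal positions have values (0,1), so among the positions in [P] they can lie only in [Z].
    Disjointness is not a field: a position in both classes would have a move to another one, and so
    on without end. *)
Record dichotomy (M : moveset) (P : seq nat -> Prop) (Z O : pred (seq nat)) :=
  Dichotomy {
  dich_closed : forall x y, P x -> move M x y -> P y;
  dich_Z : forall x y, P x -> Z x -> move M x y -> O y;
  dich_O : forall x y, P x -> O x -> move M x y -> Z y;
  dich_O_move : forall x, P x -> O x -> exists y, move M x y;
  dich_other : forall x, P x -> ~~ Z x -> ~~ O x ->
    (exists y, move M x y) /\ (forall y, move M x y -> ~~ Z y /\ ~~ O y) \/
    (exists y, move M x y /\ Z y) /\ (exists y, move M x y /\ O y)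
}.

Lemma mixed_options (M : moveset) (Z O : pred (seq nat)) x y z :
  move M x y -> move M x z -> Z y && O z || O y && Z z ->
  (exists w, move M x w /\ Z w) /\ (exists w, move M x w /\ O w).
Proof.
move=> xy xz /orP[]/andP[Hy Hz]; first by split; [exists y | exists z].
by split; [exists z | exists y].
Qed.

Lemma dichotomy_values (M : moveset) P Z O x : dichotomy M P Z O -> P x ->
  [/\ Z x -> tl_position M x 0 1, O x -> tl_position M x 1 0
    & ~~ Z x -> ~~ O x -> sprague_grundy M x = misere_grundy M x].
Proof.
move=> D; have [n] := ubnP (size x + sumn x).
elim: n x => // n IHn x le_x Px.
have IH y: move M x y ->
    [/\ Z y -> tl_position M y 0 1, O y -> tl_position M y 1 0
      & ~~ Z y -> ~~ O y -> sprague_grundy M y = misere_grundy M y].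
  move=> xy; apply: IHn; last exact: (dich_closed D Px xy).
  exact: leq_trans (move_measure xy) _.
split=> [Zx | Ox | nZ nO].
- split; [apply: value_eq0 | apply: value_eq1]; try by left.
    by move=> y xy; have [_ /(_ (dich_Z D Px Zx xy))[e _] _] := IH y xy;
      rewrite [value _ _ _]e.
  by move=> y xy; have [_ /(_ (dich_Z D Px Zx xy))[_ e] _] := IH y xy;
      rewrite [value _ _ _]e.
- have mv := dich_O_move D Px Ox.
  split; [apply: value_eq1 | apply: value_eq0]; try by right.
    by move=> y xy; have [/(_ (dich_O D Px Ox xy))[e _] _ _] := IH y xy;
      rewrite [value _ _ _]e.
  by move=> y xy; have [/(_ (dich_O D Px Ox xy))[_ e] _ _] := IH y xy;
      rewrite [value _ _ _]e.
have [[mv no]|[[z [xz Zz]] [o [xo Oo]]]] := dich_other D Px nZ nO.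
  rewrite /sprague_grundy /misere_grundy !value_move //; congr mex.
  apply/eq_in_map=> y /optionsP xy.
  by have [nZy nOy] := no y xy; have [_ _] := IH y xy; apply.
rewrite /sprague_grundy /misere_grundy !value_move; try by exists z.
have [/(_ Zz)[z0 z1] _ _] := IH z xz; have [_ /(_ Oo)[o0 o1] _] := IH o xo.
move/optionsP: xz => xz; move/optionsP: xo => xo.
(* Both sets of option values contain 0 and 1: the normal value 0 of an option in [Z] is matched by
   the misère value 0 of [o], the normal value 1 of one in [O] by the misère value 1 of [z], and
   conversely. All other options have equal values. *)
apply: eq_mex => n0; apply/idP/idP=> /mapP[y xy ->]; apply/mapP;
  have [Zy Oy Ny] := IH y (optionsP _ _ _ xy).
- case Zb: (Z y).
    by have [e _] := Zy Zb; exists o => //; exact: etrans e (esym o1).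
  case Ob: (O y).
    by have [e _] := Oy Ob; exists z => //; exact: etrans e (esym z1).
  by exists y => //; apply: Ny; rewrite ?Zb ?Ob.
- case Zb: (Z y).
    by have [_ e] := Zy Zb; exists o => //; exact: etrans e (esym o0).
  case Ob: (O y).
    by have [_ e] := Oy Ob; exists z => //; exact: etrans e (esym z0).
  by exists y => //; apply/esym/Ny; rewrite ?Zb ?Ob.
Qed.

(** For the converse directions: outside both classes the two values agree, so they cannot be 0 and
    1 in either order. *)
Lemma dichotomy_tlP (M : moveset) P Z O x : dichotomy M P Z O -> P x ->
  (tl_position M x 0 1 <-> Z x) /\ (tl_position M x 1 0 <-> O x).
Proof.
move=> D Px; have [Zx Ox Nx] := dichotomy_values D Px.
split; split=> // -[v0 v1].
  apply/negPn/negP=> nZ; case Ob: (O x).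
    by have [] := Ox Ob; rewrite v0.
  by have:= Nx nZ (negbT Ob); rewrite v0 v1.
apply/negPn/negP=> nO; case Zb: (Z x).
  by have [] := Zx Zb; rewrite v0.
by have:= Nx (negbT Zb) nO; rewrite v0 v1.
Qed.

Lemma dichotomy_position (M : moveset) P Z O lam x :
  dichotomy M P Z O -> P lam -> position M lam x -> P x.
Proof.
by move=> D Pl; elim=> // mu nu _ Pmu step; exact: (dich_closed D Pmu step).
Qed.

Lemma dichotomy_forced (M : moveset) P Z O :
  dichotomy M P Z O -> family_has forced M P.
Proof.
move=> D lam Pl x y pos_x xy; have Px := dichotomy_position D Pl pos_x.
have [Zx Ox] := dichotomy_tlP D Px.
have [Zy Oy] := dichotomy_tlP D (dich_closed D Px xy).
split=> [/Zx/(dich_Z D Px)/(_ xy)/Oy | /Ox/(dich_O D Px)/(_ xy)/Zy] //.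
Qed.

Lemma dichotomy_miserable (M : moveset) P Z O :
  dichotomy M P Z O -> family_has miserable M P.
Proof.
move=> D lam Pl x pos_x; have Px := dichotomy_position D Pl pos_x.
have [Zx Ox] := dichotomy_tlP D Px.
have tlP y xy := dichotomy_tlP D (dich_closed (y := y) D Px xy).
case Zb: (Z x); first by constructor 1; left; apply/Zx.
case Ob: (O x); first by constructor 1; right; apply/Ox.
have [[_ no]|[[z [xz Zz]] [o [xo Oo]]]] := dich_other D Px (negbT Zb) (negbT Ob).
  constructor 2=> -[y [xy]]; have [/negP nZ /negP nO] := no y xy.
  by have [Zy Oy] := tlP y xy; case=> [/Zy|/Oy].
constructor 3; split; [exists z | exists o]; split=> //.
  by apply/(tlP z xz).1.
by apply/(tlP o xo).2.
Qed.

(** No option of [x] has normal value 0, since each can move to [Z]. Hence [x] has normal value 0,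
    and the same misère value, being outside both classes; a pet game has no (0,0)-position. *)
Lemma dichotomy_not_pet (M : moveset) P Z O x :
    dichotomy M P Z O -> P x -> ~~ Z x -> ~~ O x ->
    (forall y, move M x y -> exists z, move M y z /\ Z z) ->
  ~ pet M x.
Proof.
move=> D Px nZ nO opt /(_ x (position_start _ _)).
have [_ _ /(_ nZ nO) eq_v] := dichotomy_values D Px.
have sg0: sprague_grundy M x = 0.
  apply: value_eq0 => [|y xy vy]; first by left.
  have [z [yz Zz]] := opt y xy.
  have Pz: P z := dich_closed D (dich_closed D Px xy) yz.
  have [/(_ Zz)[z0 _] _ _] := dichotomy_values D Pz.
  move: vy; rewrite value_move; last by exists z.
  case/mexP=> /negP[]; apply/mapP; exists z => //; exact/optionsP.
case=> [[_]|[]|[k [k2 []]]]; rewrite -?eq_v sg0 // => def_k.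
by rewrite -def_k in k2.
Qed.

Lemma all_optionsP (M : moveset) x (Q : pred (seq nat)) y :
  all Q (options M x) -> move M x y -> Q y.
Proof. by move/allP=> QA /optionsP/QA. Qed.

Lemma has_optionsP (M : moveset) x (Q : pred (seq nat)) :
  has Q (options M x) -> exists y, move M x y /\ Q y.
Proof. by case/hasP=> y /optionsP xy Qy; exists y. Qed.

Lemma subpart_nseq n a i j :
  subpart (nseq n a) i j = if j < a then nseq (n - i) (a - j) else [::].
Proof.
rewrite /subpart drop_nseq filter_nseq /=.
by case: ifP => _; rewrite ?mul1n ?map_nseq.
Qed.


(** * King on rectangles *)

(** A single row or column of length n has [size x + head 0 x] equal to n + 1, so this class takes
    the odd lengths, including the terminal [[:: 1]]. *)
Definition king_Z (x : seq nat) :=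
  ((size x == 1) || (head 0 x == 1)) && ~~ odd (size x + head 0 x).
Definition king_O (x : seq nat) :=
  ((size x == 1) || (head 0 x == 1)) && odd (size x + head 0 x).

Lemma king_ZE a b :
  king_Z (nseq a.+1 b.+1) = ((a == 0) || (b == 0)) && ~~ odd (a + b).
Proof. by rewrite /king_Z size_nseq [head _ _]/= !eqSS addSn addnS /= negbK. Qed.

Lemma king_OE a b :
  king_O (nseq a.+1 b.+1) = ((a == 0) || (b == 0)) && odd (a + b).
Proof. by rewrite /king_O size_nseq [head _ _]/= !eqSS addSn addnS /= negbK. Qed.

Lemma move_king a b y :
  move king (nseq a.+1 b.+1) y <->
  [/\ 0 < a & y = nseq a b.+1] \/ [/\ 0 < b & y = nseq a.+1 b] \/
  [/\ 0 < a, 0 < b & y = nseq a b].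
Proof.
split.
  case=> i [j [kij -> nz]]; move: kij nz; rewrite subpart_nseq /= !inE !xpair_eqE.
  case/or3P=> /andP[/eqP-> /eqP->]; rewrite ?subSS ?subn0 ?ltnS.
  - by case: b => // b _; right; left.
  - by case: a => // a _; left.
  - by case: a => [|a]; case: b => [|b] // _; right; right.
case=> [[a0 ->]|[[b0 ->]|[a0 b0 ->]]].
- by exists 1, 0; rewrite subpart_nseq subSS !subn0; split=> //; case: a a0.
- by exists 0, 1; rewrite subpart_nseq ltnS b0 subSS !subn0.
- by exists 1, 1; rewrite subpart_nseq ltnS b0 !subSS !subn0; split=> //; case: a a0.
Qed.

Lemma king_dichotomy : dichotomy king rectangle king_Z king_O.
Proof.
have rectE x: rectangle x -> exists a b, x = nseq a.+1 b.+1.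
  by case=> -[|a] [[|b] [] // _ _ ->]; exists a, b.
split.
- move=> _ y /rectE[a [b ->]] /move_king[[a0 ->]|[[b0 ->]|[a0 b0 ->]]].
  + by exists a, b.+1.
  + by exists a.+1, b.
  + by exists a, b.
- move=> _ y /rectE[a [b ->]] + /move_king; rewrite king_ZE.
  case: a => [|a]; case: b => [|b] // even_ab [[// _ ->]|[[// _ ->]|[]//]].
    by rewrite king_OE -[odd _]negbK.
  by rewrite king_OE orbT -[odd _]negbK.
- move=> _ y /rectE[a [b ->]] + /move_king; rewrite king_OE.
  case: a => [|a]; case: b => [|b] // odd_ab [[// _ ->]|[[// _ ->]|[]//]].
    by rewrite king_ZE.
  by rewrite king_ZE orbT.
- move=> _ /rectE[a [b ->]]; rewrite king_OE.
  case: a => [|a]; case: b => [|b] // _.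
  + by exists (nseq 1 b.+1); apply/move_king; right; left.
  + by exists (nseq a.+1 1); apply/move_king; left.
move=> _ /rectE[a [b ->]]; rewrite king_ZE king_OE.
case: a => [|a]; first by case: odd.
case: b => [|b]; first by rewrite orbT; case: odd.
have mv_row: move king (nseq a.+2 b.+2) (nseq a.+1 b.+2).
  by apply/move_king; left.
have mv_col: move king (nseq a.+2 b.+2) (nseq a.+2 b.+1).
  by apply/move_king; right; left.
have mv_both: move king (nseq a.+2 b.+2) (nseq a.+1 b.+1).
  by apply/move_king; right; right.
move=> _ _; case: a => [|a] in mv_row mv_col mv_both *.
  (* With two rows, the row move and the diagonal move leave single rows of consecutive lengths,
     hence of opposite parity. Two columns are handled symmetrically. *)
  by right; apply: mixed_options mv_row mv_both _; rewrite !(king_ZE, king_OE) /=; case: odd.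
case: b => [|b] in mv_row mv_col mv_both *.
  right; apply: mixed_options mv_col mv_both _.
  by rewrite !(king_ZE, king_OE) !orbT !addn0 /=; case: odd.
(* With at least three rows and three columns, every option still has two of each. *)
left; split; first by exists (nseq a.+2 b.+3).
by move=> y /move_king[[_ ->]|[[_ ->]|[_ _ ->]]]; rewrite king_ZE king_OE.
Qed.

Lemma king_not_pet : ~ pet king (nseq 3 3).
Proof.
apply: (dichotomy_not_pet king_dichotomy) => //; first by exists 3, 3.
move=> y; move/(all_optionsP (Q := fun y => has king_Z (options king y))) => H.
by apply/has_optionsP/H; vm_compute.
Qed.

(** * Truncated staircases and their subpartitions *)

(** [steps r c d u v] is what remains of a staircase with [r.+1 x c.+1] blocks
    when the topmost block row has [u.+1] rows left, the leftmost block column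
    has [v.+1] columns left, and [d] further blocks follow in each direction. *)
Fixpoint steps (r c d u v : nat) : seq nat :=
  nseq u.+1 (d * c.+1 + v.+1) ++
  (if d is d'.+1 then steps r c d' r v else [::]).

Lemma steps_gt r c d u v x : x \in steps r c d u v -> v < x.
Proof.
elim: d u => [|d IHd] u; rewrite mem_cat mem_nseq.
  by rewrite in_nil orbF => /andP[_ /eqP->].
by case/orP=> [/andP[_ /eqP->]|/IHd //]; rewrite leq_addl.
Qed.

Lemma subpart_rows s i : all (leq 1) s -> subpart s i 0 = drop i s.
Proof.
move=> /allP s_gt0; rewrite /subpart (eq_map subn0) map_id.
by apply/all_filterP/allP=> x /mem_drop/s_gt0.
Qed.

Lemma subpart_steps_rows r c d u v i :
  subpart (steps r c d u v) i 0 = drop i (steps r c d u v).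
Proof.
apply: subpart_rows; apply/allP=> x /steps_gt v_lt_x.
exact: leq_ltn_trans v_lt_x.
Qed.

(** This lets a column cut be made in two stages, so that whole block columns can be peeled off by
    induction. *)
Lemma subpart_add s i j k : subpart s i (j + k) = subpart (subpart s i j) 0 k.
Proof.
rewrite /subpart drop0 filter_map -map_comp -filter_predI.
rewrite (eq_map (g := (fun x => x - k) \o (fun x => x - j))); last first.
  by move=> x /=; rewrite subnDA.
congr map; apply: eq_filter => x /=; rewrite ltn_subRL.
by apply/idP/andP=> [lt_x|[]//]; rewrite (leq_ltn_trans (leq_addr k j)).
Qed.

Lemma subpart_split s i j : subpart s i j = subpart (subpart s i 0) 0 j.
Proof. by rewrite -subpart_add. Qed.

Lemma drop_steps_small r c d u v i :
  i <= u -> drop i (steps r c d u v) = steps r c d (u - i) v.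
Proof.
move=> le_iu; case: d => [|d]; rewrite /steps -/steps drop_cat size_nseq ltnS le_iu;
  by rewrite drop_nseq subSn.
Qed.

Lemma drop_steps_block r c d u v :
  drop u.+1 (steps r c d.+1 u v) = steps r c d r v.
Proof. by rewrite /steps -/steps drop_size_cat // size_nseq. Qed.

Lemma subpart_cols_small r c d u v j :
  j <= v -> subpart (steps r c d u v) 0 j = steps r c d u (v - j).
Proof.
move=> le_jv; rewrite /subpart drop0.
elim: d u => [|d IHd] u; rewrite /steps -/steps filter_cat map_cat ?IHd;
  rewrite filter_nseq /= ltn_addl ?ltnS // mul1n map_nseq;
  by rewrite -addnBA ?subSn // leqW.
Qed.

Lemma stepsE r c d u v :
  steps r c d u v = nseq u.+1 (d * c.+1 + v.+1) ++
    (if d is d'.+1 then steps r c d' r v else [::]).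
Proof. by case: d. Qed.

Lemma subpart_cols_cat s t j :
  subpart (s ++ t) 0 j = subpart s 0 j ++ subpart t 0 j.
Proof. by rewrite /subpart !drop0 filter_cat map_cat. Qed.

(** The bottom block row has length exactly [v.+1] and vanishes. The other rows lose the partial
    block column, and a full one of width [c.+1] becomes leftmost. *)
Lemma subpart_cols_block r c d u v :
  subpart (steps r c d u v) 0 v.+1 =
    if d is d'.+1 then steps r c d' u c else [::].
Proof.
elim: d u => [|d IHd] u; rewrite stepsE subpart_cols_cat subpart_nseq.
  by rewrite ltnn.
rewrite -[X in X < _]add0n ltn_add2r addnK subn0 IHd mulSnr [RHS]stepsE.
by rewrite addn_gt0 orbT.
Qed.

(** A cut inside the top block row only lowers [u]. A longer cut first uses up that block row,
    leaving a full one on top and one block fewer, so induction on [d] applies. *)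
Lemma subpart_steps_rowsP r c d u v i :
  u <= r -> subpart (steps r c d u v) i 0 <> [::] ->
  exists d' u', u' <= r /\ subpart (steps r c d u v) i 0 = steps r c d' u' v.
Proof.
rewrite subpart_steps_rows; elim: d u i => [|d IHd] u i le_ur.
all: have [le_iu|lt_ui] := leqP i u.
- by exists 0, (u - i); rewrite drop_steps_small // (leq_trans (leq_subr _ _)).
- by rewrite drop_oversize // stepsE cats0 size_nseq.
- by exists d.+1, (u - i); rewrite drop_steps_small // (leq_trans (leq_subr _ _)).
by rewrite -(subnK lt_ui) -drop_drop drop_steps_block; apply: IHd.
Qed.

Lemma subpart_steps_colsP r c d u v j :
  v <= c -> subpart (steps r c d u v) 0 j <> [::] ->
  exists d' v', v' <= c /\ subpart (steps r c d u v) 0 j = steps r c d' u v'.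
Proof.
elim: d v j => [|d IHd] v j le_vc.
all: have [le_jv|lt_vj] := leqP j v.
- by exists 0, (v - j); rewrite subpart_cols_small // (leq_trans (leq_subr _ _)).
- by rewrite -(subnKC lt_vj) subpart_add subpart_cols_block.
- by exists d.+1, (v - j); rewrite subpart_cols_small // (leq_trans (leq_subr _ _)).
by rewrite -(subnKC lt_vj) subpart_add subpart_cols_block; apply: IHd.
Qed.

Lemma steps_neq0 r c d u v : steps r c d u v <> [::].
Proof. by rewrite stepsE. Qed.

Lemma drop_steps_lt r c d u v d' u' :
  d' < d -> u' <= r ->
  exists2 i, 0 < i & drop i (steps r c d u v) = steps r c d' u' v.
Proof.
move=> lt_d le_u'r; elim: d u lt_d => // d IHd u.
rewrite ltnS leq_eqVlt => /predU1P[->|/(IHd r)[i _ def_i]].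
  (* Here [u.+1] rows exhaust the top block row, and [r - u'] more leave [u'.+1] of the [r.+1] rows
     of the next. *)
  exists ((r - u') + u.+1); first by rewrite addnS.
  by rewrite -drop_drop drop_steps_block drop_steps_small ?leq_subr ?subKn.
by exists (i + u.+1); [rewrite addnS | rewrite -drop_drop drop_steps_block].
Qed.

Lemma subpart_steps_lt r c d u v d' v' :
  d' < d -> v' <= c ->
  exists2 j, 0 < j & subpart (steps r c d u v) 0 j = steps r c d' u v'.
Proof.
move=> lt_d le_v'c; elim: d v lt_d => // d IHd v.
rewrite ltnS leq_eqVlt => /predU1P[->|/(IHd c)[j _ def_j]].
  exists (v.+1 + (c - v')) => //.
  by rewrite subpart_add subpart_cols_block subpart_cols_small ?leq_subr ?subKn.
by exists (v.+1 + j); rewrite // subpart_add subpart_cols_block.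
Qed.

(** * Rook on truncated staircases *)

Lemma rook_rows r c d u v d' u' :
  d' < d /\ u' <= r \/ d' = d /\ u' < u ->
  move rook (steps r c d u v) (steps r c d' u' v).
Proof.
case=> [[lt_d le_u']|[-> lt_u]].
  have [i i0 def_i] := drop_steps_lt c u v lt_d le_u'; exists i, 0.
  split; [by rewrite /= i0 | | exact: steps_neq0].
  by rewrite subpart_steps_rows.
exists (u - u'), 0; split; [by rewrite /= subn_gt0 lt_u | | exact: steps_neq0].
by rewrite subpart_steps_rows drop_steps_small ?leq_subr // subKn // ltnW.
Qed.

Lemma rook_cols r c d u v d' v' :
  d' < d /\ v' <= c \/ d' = d /\ v' < v ->
  move rook (steps r c d u v) (steps r c d' u v').
Proof.
case=> [[lt_d le_v']|[-> lt_v]].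
  have [j j0 def_j] := subpart_steps_lt r u v lt_d le_v'; exists 0, j.
  by split; [rewrite /= j0 | | exact: steps_neq0].
exists 0, (v - v'); split; [by rewrite /= subn_gt0 lt_v | | exact: steps_neq0].
by rewrite subpart_cols_small ?leq_subr // subKn // ltnW.
Qed.

Lemma rook_stepsP r c d u v y :
  u <= r -> v <= c -> move rook (steps r c d u v) y ->
  (exists d' u', u' <= r /\ y = steps r c d' u' v) \/
  (exists d' v', v' <= c /\ y = steps r c d' u v').
Proof.
move=> le_ur le_vc [i [j [/orP[]/andP[]]]].
  by move=> _ /eqP-> -> nz; left; apply: subpart_steps_rowsP.
by move=> /eqP-> _ -> nz; right; apply: subpart_steps_colsP.
Qed.

Definition steps_position (x : seq nat) : Prop :=
  exists r c d u v, [/\ u <= r, v <= c & x = steps r c d u v].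

Definition rook_Z (x : seq nat) := x \in [:: [:: 1]; [:: 2; 2]].
Definition rook_O (x : seq nat) := x \in [:: [:: 2]; [:: 1; 1]; [:: 2; 1]].

(** Every member of the two classes has at most two rows and first entry at most 2. *)
Lemma steps_other r c d u v :
  (1 < u) || (1 < v) -> ~~ rook_Z (steps r c d u v) /\ ~~ rook_O (steps r c d u v).
Proof.
move=> big.
have: (2 < size (steps r c d u v)) || (2 < head 0 (steps r c d u v)).
  rewrite stepsE size_cat size_nseq /=.
  case/orP: big => big; first by rewrite ltn_addr.
  by apply/orP; right; rewrite ltn_addl.
move: (steps r c d u v) => x {}big; rewrite /rook_Z /rook_O !inE.
split; apply/negP; first by case/orP=> /eqP def_x; rewrite def_x in big.
by case/or3P=> /eqP def_x; rewrite def_x in big.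
Qed.

Lemma rook_dichotomy : dichotomy rook steps_position rook_Z rook_O.
Proof.
split.
- move=> _ y [r [c [d [u [v [le_ur le_vc ->]]]]]] /(rook_stepsP le_ur le_vc).
  case=> -[d' [w [le_w ->]]]; first by exists r, c, d', w, v.
  by exists r, c, d', u, w.
- move=> x y _; rewrite /rook_Z !inE => /orP[]/eqP->; apply: all_optionsP;
    by vm_compute.
- move=> x y _; rewrite /rook_O !inE => /or3P[]/eqP->; apply: all_optionsP;
    by vm_compute.
- move=> x _ Ox; suff /has_optionsP[y []]: has predT (options rook x) by exists y.
  by move: Ox; rewrite /rook_O !inE => /or3P[]/eqP->; vm_compute.
move=> _ [r [c [d [u [v [le_ur le_vc ->]]]]]].
set x := steps r c d u v => nZ nO.
(* A row move preserves [v] and a column move preserves [u], so if both exceed 1 no option lies in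
   either class. *)
have [/andP[u2 v2]|small] := boolP ((1 < u) && (1 < v)).
  left; split.
    by exists (steps r c d 0 v); apply: rook_rows; right; split=> //; apply: ltnW.
  move=> y /(rook_stepsP le_ur le_vc)[]-[d' [w [_ ->]]]; apply: steps_other.
    by rewrite v2 orbT.
  by rewrite u2.
right.
(* Row moves reach the last block with one row or two rows left, of length [v.+1]. For [v = 0] these
   are [1] in [Z] and [1,1] in [O]; for [v = 1] they are [2] in [O] and [2,2] in [Z]. *)
have rows: v <= 1 -> 0 < d /\ 0 < r \/ d = 0 /\ 1 < u ->
    (exists w, move rook x w /\ rook_Z w) /\ (exists w, move rook x w /\ rook_O w).
  move=> v1 big; apply: (mixed_options (y := steps r c 0 0 v) (z := steps r c 0 1 v)).
  - by apply: rook_rows; case: big => [[]|[->]]; [left | right; split=> //; apply: ltnW].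
  - by apply: rook_rows; case: big => [[]|[->]]; [left | right].
  - by case: v v1 {le_vc x nZ nO small big} => [|[]].
have cols: u <= 1 -> 0 < d /\ 0 < c \/ d = 0 /\ 1 < v ->
    (exists w, move rook x w /\ rook_Z w) /\ (exists w, move rook x w /\ rook_O w).
  move=> u1 big; apply: (mixed_options (y := steps r c 0 u 0) (z := steps r c 0 u 1)).
  - by apply: rook_cols; case: big => [[]|[->]]; [left | right; split=> //; apply: ltnW].
  - by apply: rook_cols; case: big => [[]|[->]]; [left | right].
  - by case: u u1 {le_ur x nZ nO small big rows} => [|[]].
have [d0|d_gt0] := posnP d.
  have [u1|u2] := leqP u 1; last first.
    by apply: rows; [rewrite u2 -leqNgt in small | right].
  have [v1|v2] := leqP v 1; last by apply: cols => //; right.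
  (* A single block with at most two rows and columns is one of [1], [2], [1,1], [2,2], all in the
     classes. *)
  move: nZ nO; rewrite /x d0.
  by case: u u1 {x rows cols small le_ur d0} => [|[]] // _; case: v v1 {le_vc} => [|[]].
have [r0|r_gt0] := posnP r; have [c0|c_gt0] := posnP c.
(* With 1 x 1 blocks, row moves reach [1] in [Z] and [2,1] in [O]. The latter needs [d > 1], and
   [d = 1] would make [x] itself [2,1]. *)
- move: le_ur le_vc; rewrite r0 c0 !leqn0 => /eqP u0 /eqP v0.
  apply: (mixed_options (y := steps r c 0 0 v) (z := steps r c 1 0 v)).
  + by apply: rook_rows; left.
  + apply: rook_rows; left; split=> //; rewrite ltn_neqAle d_gt0 andbT.
    by apply/eqP=> d1; move: nO; rewrite /x -d1 u0 v0 r0 c0.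
  + by rewrite v0 r0 c0.
- by apply: cols; [rewrite r0 in le_ur; apply: leq_trans le_ur _ | left].
- by apply: rows; [rewrite c0 in le_vc; apply: leq_trans le_vc _ | left].
move: small; rewrite negb_and -!leqNgt => /orP[u1|v1].
  by apply: cols; [|left].
by apply: rows; [|left].
Qed.

Lemma rook_not_pet : ~ pet rook (nseq 3 3).
Proof.
apply: (dichotomy_not_pet rook_dichotomy) => //; first by exists 2, 2, 0, 2, 2.
move=> y; move/(all_optionsP (Q := fun y => has rook_Z (options rook y))) => H.
by apply/has_optionsP/H; vm_compute.
Qed.

(** * From staircases to truncated staircases, and the three families *)

Lemma staircase_steps r c k : staircase r.+1 c.+1 k.+1 = steps r c k r c.
Proof.
elim: k => [|k IHk]; first by rewrite /staircase /= mul1n.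
rewrite stepsE -IHk /staircase -[k.+2]addn1 iotaD rev_cat map_cat flatten_cat /=.
by rewrite cats0 add1n mulSnr.
Qed.

Lemma staircase_subpartition_steps lam :
  staircase_subpartition lam -> steps_position lam.
Proof.
case=> -[|r] [[|c] [[|k] [i [j []]]]] // _ _ _ ->.
(* Rows are cut first: this leaves [v = c], so the column lemma still applies to the result. *)
rewrite staircase_steps subpart_split => nz.
have nz_i: subpart (steps r c k r c) i 0 <> [::] by move=> e; rewrite e in nz.
have [d [u [le_ur def_i]]] := subpart_steps_rowsP (leqnn r) nz_i.
rewrite def_i in nz *.
have [d' [v [le_vc ->]]] := subpart_steps_colsP (leqnn c) nz.
by exists r, c, d', u, v.
Qed.

Lemma rectangle_staircase_subpartition lam :
  rectangle lam -> staircase_subpartition lam.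
Proof.
case=> -[|r] [[|c] [// _ _ ->]]; exists r.+1, c.+1, 1, 0, 0; split=> //.
suff -> : staircase r.+1 c.+1 1 = nseq r.+1 c.+1 by rewrite subpart_nseq !subn0.
by rewrite /staircase /= mul1n cats0.
Qed.

Lemma family_has_sub prop M (P Q : seq nat -> Prop) :
  (forall lam, P lam -> Q lam) -> family_has prop M Q -> family_has prop M P.
Proof. by move=> PQ has_Q lam /PQ/has_Q. Qed.

Theorem theorem4p10 :
  [/\ family_has forced rook rectangle,
      family_has miserable rook rectangle
    & family_fails pet rook rectangle] /\
  [/\ family_has forced king rectangle,
      family_has miserable king rectangle
    & family_fails pet king rectangle] /\
  [/\ family_has forced rook staircase_subpartition,
      family_has miserable rook staircase_subpartition
    & family_fails pet rook staircase_subpartition].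
Proof.
have rect33: rectangle (nseq 3 3) by exists 3, 3.
have rookF := family_has_sub staircase_subpartition_steps
                (dichotomy_forced rook_dichotomy).
have rookM := family_has_sub staircase_subpartition_steps
                (dichotomy_miserable rook_dichotomy).
split; [|split]; split=> //.
- exact: family_has_sub rectangle_staircase_subpartition rookF.
- exact: family_has_sub rectangle_staircase_subpartition rookM.
- by exists (nseq 3 3); split; last exact: rook_not_pet.
- exact: dichotomy_forced king_dichotomy.
- exact: dichotomy_miserable king_dichotomy.
- by exists (nseq 3 3); split; last exact: king_not_pet.
- exists (nseq 3 3); split; last exact: rook_not_pet.
  exact: rectangle_staircase_subpartition.
Qed.
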